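(* Let $\Bbbk$ be a field, $n\ge1$, and let $A$ be the incidence algebra over $\Bbbk$ of the commutative ladder of length $n$, with set of intervals $\mathbb{I}$. Let $r$ be the interval resolution global dimension of $A$ (which is finite), and let $M\in\operatorname{mod}A$ have an interval resolution $$0\to\bigoplus_{J\in\mathbb{I}}V_J^{d_J^{(r)}}\xrightarrow{f_r}\cdots\xrightarrow{f_2}\bigoplus_{J\in\mathbb{I}}V_J^{d_J^{(1)}}\xrightarrow{f_1}\bigoplus_{J\in\mathbb{I}}V_J^{d_J^{(0)}}\xrightarrow{f_0}M\to0$$ with non-negative integers $d_J^{(i)}$ ($0\le i\le r$, $J\in\mathbb{I}$). Then for every $I\in\mathbb{I}$ the compressed multiplicity $c_M^{\xi}(I)$ of $V_I$ in $M$ with respect to $\xi$ satisfies $$c_M^{\xi}(I)=\sum_{J\in\mathbb{I},\ I\subseteq J}\ \sum_{i=0}^r(-1)^i d_J^{(i)} .$$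
   Context: Commutative ladder. The poset $\mathcal{P}=\{x_1,\dots,x_n,y_1,\dots,y_n\}$ with $x_i\le x_j$, $y_i\le y_j$, $x_i\le y_j$ each holding exactly when $i\le j$, and never $y_i\le x_j$ (i.e. the product $\{1<\dots<n\}\times\{1<2\}$ with $x_i=(i,1)$, $y_i=(i,2)$). $A$ is its incidence algebra, also regarded as the $\Bbbk$-linear category with object set $\mathcal{P}$ in which $A(p,q)$ is one-dimensional with distinguished basis element $u_{q,p}$ if $p\le q$ and is $0$ otherwise, with $u_{s,q}u_{q,p}=u_{s,p}$ and $u_{p,p}$ the identity. $\operatorname{mod}A$ is the category of functors $\mathcal{P}\to\mathrm{vect}_\Bbbk$ into finite-dimensional spaces (equivalently $\Bbbk$-linear functors from the category $A$). Intervals. An interval is a nonempty subset of $\mathcal{P}$ that is convex ($p,q\in S$, $p\le x\le q$ imply $x\in S$) and connected in the Hasse diagram; $\mathbb{I}$ is the set of intervals. $V_I$ is the module with $V_I(x)=\Bbbk$ for $x\in I$, $0$ otherwise, and identity maps between comparable points of $I$. Each interval is exactly one of: (i) $\{x_i,\dots,x_j\}\cup\{y_k,\dots,y_l\}$ with $1\le k\le i\le l\le j\le n$; (ii) $\{x_i,\dots,x_j\}$ with $1\le i\le j\le n$; (iii) $\{y_k,\dots,y_l\}$ with $1\le k\le l\le n$. Interval resolutions. Let $\mathcal{I}$ be the full subcategory of finite direct sums of interval modules. A right $\mathcal{I}$-approximation of $M$ is a morphism $f:X\to M$ with $X\in\mathcal{I}$ through which every morphism $Y\to M$ with $Y\in\mathcal{I}$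 factors. An interval resolution of $M$ is a sequence $\cdots\to X_1\xrightarrow{f_1}X_0\xrightarrow{f_0}M\to0$ where $f_0$ is a right $\mathcal{I}$-approximation of $M$ and each $f_i$ ($i\ge1$) induces a right $\mathcal{I}$-approximation of $\operatorname{Ker}f_{i-1}$. The interval resolution dimension of $M$ is the least length $m$ of an interval resolution $0\to X_m\to\cdots\to X_0\to M\to0$; the interval resolution global dimension of $A$ is the supremum of these over all $M\in\operatorname{mod}A$. The quiver $Q'$ and the functors. Let $Q'$ be the quiver with vertices $1,2,3,4,5$ and arrows $\alpha_1:2\to1$, $\alpha_2:2\to3$, $\alpha_3:4\to3$, $\alpha_4:4\to5$; let $B=\Bbbk Q'$ be its path category, and $\operatorname{mod}B$ the category of finite-dimensional representations of $Q'$. For $I\in\mathbb{I}$ define $\xi_I$ on the vertices $(1,2,3,4,5)$ by: $(y_l,y_k,y_i,x_i,x_j)$ in case (i); $(x_j,x_i,x_i,x_i,x_j)$ in case (ii); $(y_l,y_k,y_k,y_k,y_l)$ in case (iii). Each arrow $\alpha:a\to b$ of $Q'$ is sent to the distinguished morphism $u_{\xi_I(b),\xi_I(a)}$ (the identity if $\xi_I(a)=\xi_I(b)$). This extends uniquely to a $\Bbbk$-linear functor $F_I:B\to A$. Let $R_I:\operatorname{mod}A\to\operatorname{mod}B$, $R_I(M)=M\circ F_I$. Compressed multiplicity. $c_M^{\xi}(I)$ is the multiplicity of the (indecomposable) $B$-module $R_I(V_I)$ as a direct summand in the Krull–Schmidt decomposition of $R_I(M)$. ($R_I(V_I)$ is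 the representation of $Q'$ with $\Bbbk$ at every vertex and identity maps.) *)

(* Defs.v *)
From HB Require Import structures.
From mathcomp Require Import all_boot all_order all_algebra.
From mathcomp Require Import boolp classical_sets.

Set Implicit Arguments.
Unset Strict Implicit.
Unset Printing Implicit Defensive.

Import Order.TTheory GRing.Theory.
Local Open Scope ring_scope.

(* Vertices and arrows may form arbitrary types. Both [mod B] (representations
   of a quiver) and [mod A] (functors on a poset, see [pmod]) are built on the
   representations below, so that morphisms, isomorphisms and direct sums are
   defined once. *)
Record quiver := Quiver {
  vertex :> Type;
  arrow : vertex -> vertex -> Type }.

Record rep (k : fieldType) (Q : quiver) := Rep {
  rep_sp :> Q -> vectType k;
  rep_map : forall a b : Q, arrow a b -> 'Hom(rep_sp a, rep_sp b) }.
Arguments rep_map {k Q} N {a b} e : rename.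

Section Representations.
Variables (k : fieldType) (Q : quiver).
Implicit Types N X Y : rep k Q.

Record rhom N X := RHom {
  rhom_map :> forall a : Q, 'Hom(N a, X a);
  rhom_nat : forall (a b : Q) (e : arrow a b),
    (rhom_map b \o rep_map N e)%VF = (rep_map X e \o rhom_map a)%VF }.

Definition is_zero N := forall a : Q, \dim {: N a} = 0%N.

Definition iso N X := exists (f : rhom N X) (g : rhom X N),
  forall a, (g a \o f a)%VF = \1%VF /\ (f a \o g a)%VF = \1%VF.

(* [X] is a biproduct of the family [E], i.e. X ~ \bigoplus_t E t; this
   determines [X] up to isomorphism. *)
Definition is_dsum (T : finType) (E : T -> rep k Q) X :=
  exists (inj : forall t, rhom (E t) X) (prj : forall t, rhom X (E t)),
  [/\ forall t a, (prj t a \o inj t a)%VF = \1%VF,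
      forall s t a, s != t -> (prj t a \o inj s a)%VF = 0
    & forall a, \sum_t (inj t a \o prj t a)%VF = \1%VF].

Definition indecomposable N :=
  ~ is_zero N /\
  forall E : bool -> rep k Q, is_dsum E N -> is_zero (E false) \/ is_zero (E true).

Definition is_multiplicity Z N (m : nat) :=
  exists (T : finType) (E : T -> rep k Q),
  [/\ forall t, indecomposable (E t), is_dsum E N
    & #|[set t | `[< iso (E t) Z >]]| = m].

(* When Q has finitely many vertices, exactly one [m] satisfies
   [is_multiplicity Z N] by the Krull-Schmidt theorem, so the default value 0 is
   never used. *)
Definition multiplicity Z N : nat :=
  xget 0%N (is_multiplicity Z N : set nat).

End Representations.

Section PosetModules.
Variables (disp : Order.disp_t) (P : finPOrderType disp).

Definition poset_quiver : quiver :=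
  @Quiver P (fun p q => is_true (p <= q)%O).

Variable k : fieldType.

Record pmod := PMod {
  pmod_rep :> rep k poset_quiver;
  pmod_id : forall (p : P) (h : (p <= p)%O),
    @rep_map k poset_quiver pmod_rep p p h = \1%VF;
  pmod_comp : forall (p q s : P) (h1 : (p <= q)%O) (h2 : (q <= s)%O) (h : (p <= s)%O),
    (@rep_map k poset_quiver pmod_rep q s h2 \o @rep_map k poset_quiver pmod_rep p q h1)%VF
      = @rep_map k poset_quiver pmod_rep p s h }.
Implicit Types M X Y : pmod.

Section Kernel.
Variables (X M : pmod) (f : rhom X M).

Definition ker_sp (p : P) : vectType k := subvs_of (lker (f p)).

Definition ker_map (p q : poset_quiver) (h : arrow p q) : 'Hom(ker_sp p, ker_sp q) :=
  (linfun (vsproj (lker (f q))) \o rep_map X h \o linfun (@vsval _ _ (lker (f p))))%VF.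

Definition ker_rep : rep k poset_quiver := Rep ker_map.

Lemma ker_mapE (p q : poset_quiver) (h : arrow p q) (v : ker_sp p) :
  vsval (ker_map h v) = rep_map X h (vsval v).
Proof.
rewrite /ker_map !comp_lfunE !lfunE /= vsprojK //.
rewrite memv_ker -comp_lfunE (rhom_nat f h) comp_lfunE.
by have := subvsP v; rewrite memv_ker => /eqP ->; rewrite linear0.
Qed.

Fact ker_id (p : P) (h : (p <= p)%O) : @rep_map k poset_quiver ker_rep p p h = \1%VF.
Proof.
apply/lfunP => v; apply: val_inj.
transitivity (rep_map X (h : @arrow poset_quiver p p) (vsval v)).
  exact: ker_mapE.
by rewrite pmod_id !id_lfunE.
Qed.

Fact ker_comp (p q s : P) (h1 : (p <= q)%O) (h2 : (q <= s)%O) (h : (p <= s)%O) :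
  (@rep_map k poset_quiver ker_rep q s h2 \o @rep_map k poset_quiver ker_rep p q h1)%VF
    = @rep_map k poset_quiver ker_rep p s h.
Proof.
apply/lfunP => v; apply: val_inj.
transitivity (rep_map X (h : @arrow poset_quiver p s) (vsval v)); last first.
  by symmetry; exact: ker_mapE.
rewrite comp_lfunE -(pmod_comp X h1 h2 h) comp_lfunE.
transitivity (rep_map X (h2 : @arrow poset_quiver q s)
                (vsval (ker_map (h1 : @arrow poset_quiver p q) v))).
  exact: ker_mapE.
by congr (rep_map _ _ _); exact: ker_mapE.
Qed.

Definition ker_pmod : pmod := PMod ker_id ker_comp.

Fact ker_incl_nat (p q : poset_quiver) (h : arrow p q) :
  (linfun (@vsval _ _ (lker (f q))) \o rep_map ker_pmod h)%VF
    = (rep_map X h \o linfun (@vsval _ _ (lker (f p))))%VF.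
Proof.
apply/lfunP => v; rewrite [LHS]comp_lfunE [RHS]comp_lfunE.
by rewrite [LHS]lfunE [in RHS]lfunE; exact: ker_mapE.
Qed.

Definition ker_incl : rhom ker_pmod X := RHom ker_incl_nat.

End Kernel.

Definition covers (p q : P) := (p < q)%O && ~~ [exists z, (p < z < q)%O].

Definition hasse_adj (S : {set P}) : rel P :=
  [rel p q | [&& p \in S, q \in S & covers p q || covers q p]].

Definition is_interval (S : {set P}) :=
  [&& S != finset.set0,
      [forall p in S, forall q in S, forall z, (p <= z <= q)%O ==> (z \in S)]
    & [forall p in S, forall q in S, connect (hasse_adj S) p q]].

Definition pinterval := {S : {set P} | is_interval S}.

Lemma interval_convex (I : pinterval) (p z q : P) :
  p \in val I -> q \in val I -> (p <= z)%O -> (z <= q)%O -> z \in val I.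
Proof.
case/and3P: (valP I) => _ /forall_inP cI _ pI qI pz zq.
by have /forall_inP/(_ q qI)/forallP/(_ z) := cI p pI; rewrite pz zq.
Qed.

Fact mulmx_const1 (b : bool) (v : 'rV[k]_b) : v *m (const_mx 1 : 'M[k]_(b, b)) = v.
Proof.
case: b v => v; apply/rowP => i; last by case: i.
by rewrite mxE big_ord1 !mxE mulr1 [i]ord1.
Qed.

Section IntervalModule.
Variable I : pinterval.

(* One-dimensional for p in I, and zero otherwise. *)
Definition int_sp (p : P) : vectType k := 'rV[k]_(p \in val I).

(* The identity of 'rV[k]_1 when p and q are both in I. *)
Definition int_map (p q : poset_quiver) (h : arrow p q) : 'Hom(int_sp p, int_sp q) :=
  linfun (mulmxr (const_mx 1 : 'M[k]_(p \in val I, q \in val I))).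

Definition int_rep : rep k poset_quiver := Rep int_map.

Fact int_id (p : P) (h : (p <= p)%O) : @rep_map k poset_quiver int_rep p p h = \1%VF.
Proof.
apply/lfunP => v; rewrite id_lfunE lfunE; exact: mulmx_const1.
Qed.

Fact int_comp (p q s : P) (h1 : (p <= q)%O) (h2 : (q <= s)%O) (h : (p <= s)%O) :
  (@rep_map k poset_quiver int_rep q s h2 \o @rep_map k poset_quiver int_rep p q h1)%VF
    = @rep_map k poset_quiver int_rep p s h.
Proof.
apply/lfunP => v; rewrite comp_lfunE !lfunE /= -mulmxA; congr (_ *m _).
have := fun pI sI => @interval_convex I p q s pI sI h1 h2.
case: (p \in val I); case: (q \in val I); case: (s \in val I) => //= H;
  apply/matrixP => i j; try by [case: i | case: j].
  by rewrite mxE big_ord1 !mxE mulr1.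
by have := H isT isT.
Qed.

Definition int_mod : pmod := PMod int_id int_comp.

End IntervalModule.

Definition int_decomposable X :=
  exists (T : finType) (J : T -> pinterval),
    is_dsum (fun t => int_mod (J t) : rep k poset_quiver) X.

(* X ~ \bigoplus_J V_J^(d J). *)
Definition is_int_sum (d : pinterval -> nat) X :=
  is_dsum (fun t : {J : pinterval & 'I_(d J)} => int_mod (tag t) : rep k poset_quiver) X.

Definition right_approx X M (f : rhom X M) :=
  int_decomposable X /\
  forall (Y : pmod) (g : rhom Y M), int_decomposable Y ->
    exists h : rhom Y X, forall p, g p = (f p \o h p)%VF.

Definition induces_ker_approx X' X M (g : rhom X' X) (f : rhom X M) :=
  exists g' : rhom X' (ker_pmod f),
    (forall p, g p = (ker_incl f p \o g' p)%VF) /\ right_approx g'.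

Record int_resolution M := IntResolution {
  res_obj :> nat -> pmod;
  res_aug : rhom (res_obj 0) M;
  res_diff : forall i, rhom (res_obj i.+1) (res_obj i);
  res_aug_approx : right_approx res_aug;
  res_diff0_approx : induces_ker_approx (res_diff 0) res_aug;
  res_diff_approx : forall i, induces_ker_approx (res_diff i.+1) (res_diff i) }.

(* The resolution has the form 0 -> X_m -> ... -> X_0 -> M -> 0. *)
Definition has_length M (X : int_resolution M) (m : nat) :=
  forall i, (m < i)%N -> is_zero (X i).

Definition is_int_res_dim M (m : nat) :=
  (exists X : int_resolution M, has_length X m) /\
  forall m', (exists X : int_resolution M, has_length X m') -> (m <= m')%N.

Definition int_res_dims_bounded (b : nat) :=
  forall M, exists2 m, is_int_res_dim M m & (m <= b)%N.

(* The supremum over all M of the interval resolution dimensions is the natural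
   number r; in particular all of these dimensions are finite. *)
Definition is_int_res_gldim (r : nat) :=
  int_res_dims_bounded r /\ forall b, int_res_dims_bounded b -> (r <= b)%N.

End PosetModules.

Arguments int_mod {disp P} k I.

(* x_i = (i, false) and y_i = (i, true), with the componentwise order. *)
Notation ladder n := ('I_n *p bool)%type.

Section Ladder.
Variable n : nat.

Definition lx (i : 'I_n) : ladder n := (i, false).
Definition ly (i : 'I_n) : ladder n := (i, true).

Inductive zvertex := v1 | v2 | v3 | v4 | v5.

Inductive zarrow : zvertex -> zvertex -> Type :=
| alpha1 : zarrow v2 v1
| alpha2 : zarrow v2 v3
| alpha3 : zarrow v4 v3
| alpha4 : zarrow v4 v5.

Definition zigzag : quiver := Quiver zarrow.

Fact arg_min_base (b i : 'I_n) (A : pred 'I_n) (F : 'I_n -> nat) :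
  A i -> [arg min_(j < b | A j) F j]%N = [arg min_(j < i | A j) F j]%N.
Proof.
rewrite /arg_min /extremum => Ai; case: pickP => //= no.
by case: (arg_minnP F Ai) => m Am mP; have := no m; rewrite /= Am /=;
  move/forall_inP => [].
Qed.

Fact arg_max_base (b i : 'I_n) (A : pred 'I_n) (F : 'I_n -> nat) :
  A i -> [arg max_(j > b | A j) F j]%N = [arg max_(j > i | A j) F j]%N.
Proof.
rewrite /arg_max /extremum => Ai; case: pickP => //= no.
by case: (arg_maxnP F Ai) => m Am mP; have := no m; rewrite /= Am /=;
  move/forall_inP => [].
Qed.

Section Xi.
Variable I : pinterval (ladder n).

Fact interval_neq0 : exists p : ladder n, p \in val I.
Proof. by case/and3P: (valP I) => /set0Pn. Qed.

Definition base : 'I_n := (xchoose interval_neq0).1.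

(* The indices i, j, k, l such that I is the union of {x_i, ..., x_j} and
   {y_k, ..., y_l}; if a row does not meet I, its two indices are junk. *)
Definition xfirst : 'I_n := [arg min_(i < base | lx i \in val I) (i : nat)]%N.
Definition xlast  : 'I_n := [arg max_(i > base | lx i \in val I) (i : nat)]%N.
Definition yfirst : 'I_n := [arg min_(i < base | ly i \in val I) (i : nat)]%N.
Definition ylast  : 'I_n := [arg max_(i > base | ly i \in val I) (i : nat)]%N.

Definition meets_x := [exists i, lx i \in val I].
Definition meets_y := [exists i, ly i \in val I].

Definition xi (a : zvertex) : ladder n :=
  if meets_x && meets_y then
    match a with
    | v1 => ly ylast | v2 => ly yfirst | v3 => ly xfirst
    | v4 => lx xfirst | v5 => lx xlast
    end
  else if meets_x then
    match a with
    | v1 => lx xlast | v2 => lx xfirst | v3 => lx xfirst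
    | v4 => lx xfirst | v5 => lx xlast
    end
  else
    match a with
    | v1 => ly ylast | v2 => ly yfirst | v3 => ly yfirst
    | v4 => ly yfirst | v5 => ly ylast
    end.

Fact xfirstP : meets_x ->
  lx xfirst \in val I /\ forall i, lx i \in val I -> (xfirst <= i)%N.
Proof.
by case/existsP => i iI; rewrite /xfirst (arg_min_base _ _ iI); case: arg_minnP.
Qed.

Fact xlastP : meets_x ->
  lx xlast \in val I /\ forall i, lx i \in val I -> (i <= xlast)%N.
Proof.
by case/existsP => i iI; rewrite /xlast (arg_max_base _ _ iI); case: arg_maxnP.
Qed.

Fact yfirstP : meets_y ->
  ly yfirst \in val I /\ forall i, ly i \in val I -> (yfirst <= i)%N.
Proof.
by case/existsP => i iI; rewrite /yfirst (arg_min_base _ _ iI); case: arg_minnP.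
Qed.

Fact ylastP : meets_y ->
  ly ylast \in val I /\ forall i, ly i \in val I -> (i <= ylast)%N.
Proof.
by case/existsP => i iI; rewrite /ylast (arg_max_base _ _ iI); case: arg_maxnP.
Qed.

Fact meets_xy : meets_x || meets_y.
Proof.
have [[i []] pI] := interval_neq0; apply/orP; [right | left];
  by apply/existsP; exists i.
Qed.

(* An interval meeting both rows contains some x_i together with y_i. *)
Fact crossing : meets_x -> meets_y -> exists i, lx i \in val I /\ ly i \in val I.
Proof.
move=> /existsP[i iI] /existsP[j jI].
have [/existsP[c /andP[]]|/existsPn nc] :=
  boolP [exists c, (lx c \in val I) && (ly c \in val I)]; first by exists c.
have /and3P[_ _ /forall_inP/(_ _ iI)/forall_inP/(_ _ jI)] := valP I.
suff clo : closed (hasse_adj (val I)) [pred p : ladder n | p.2].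
  by move/(closed_connect clo).
move=> [a s] [b t] /and3P[aI bI cov]; rewrite !inE /=.
have key c d : lx c \in val I -> ly d \in val I -> covers (lx c) (ly d) -> False.
  move=> cI dI /andP[/ltW]; rewrite leEprod => /andP[/= cd _] /existsP[].
  have := nc c; rewrite cI /= => cNI.
  have neq : c != d by apply: contraNneq cNI => ->.
  exists (ly c); rewrite !lt_def !leEprod /= !lexx cd /= !andbT.
  by rewrite -!pair_eqE /= !andbT !eqxx /= eq_sym neq.
have no c d : ~~ covers (ly c) (lx d).
  by apply/negP => /andP[/ltW]; rewrite leEprod /= andbF.
case: s t aI bI cov => -[] //= aI bI /orP[] cov.
- by have := no a b; rewrite cov.
- by case: (key b a).
- by case: (key a b).
- by have := no b a; rewrite cov.
Qed.

Fact xi_le (a b : zvertex) : zarrow a b -> (xi a <= xi b)%O.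
Proof.
rewrite /xi; have [mx|nmx] := boolP meets_x; have [my|nmy] := boolP meets_y => /=.
- have [xfI xf] := xfirstP mx; have [xlI xl] := xlastP mx.
  have [yfI yf] := yfirstP my; have [ylI yl] := ylastP my.
  have [c [cx cy]] := crossing mx my.
  have yfxf : (yfirst <= xfirst)%N.
    rewrite leqNgt; apply/negP => lt.
    have := @interval_convex _ _ I (lx xfirst) (ly xfirst) (ly c) xfI cy.
    rewrite !leEprod /= !lexx leEord xf // => /(_ isT isT)/yf.
    by rewrite leqNgt lt.
  by case; rewrite leEprod /= ?lexx ?leEord ?andbT ?yl ?xl.
- have [xfI xf] := xfirstP mx; have [xlI xl] := xlastP mx.
  by case; rewrite leEprod /= ?lexx ?leEord ?andbT ?xl.
- have [yfI yf] := yfirstP my; have [ylI yl] := ylastP my.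
  by case; rewrite leEprod /= ?lexx ?leEord ?andbT ?yl.
- by have := meets_xy; rewrite (negPf nmx) (negPf nmy).
Qed.

End Xi.

Section Compressed.
Variable k : fieldType.

(* Precomposition with the functor F_I, which maps each vertex a to xi I a and
   each arrow to the comparison of its endpoints. *)
Definition restrict (I : pinterval (ladder n)) (M : pmod (ladder n) k) : rep k zigzag :=
  @Rep k zigzag (fun a : zvertex => M (xi I a))
    (fun (a b : zvertex) (e : zarrow a b) =>
       @rep_map k (poset_quiver (ladder n)) M (xi I a) (xi I b) (xi_le I e)).

Definition compressed_multiplicity (M : pmod (ladder n) k) (I : pinterval (ladder n)) : nat :=
  multiplicity (restrict I (int_mod k I)) (restrict I M).

End Compressed.
End Ladder.

(* Main.v *)
(* The compression of M along xi is a representation N of the zigzag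
   N1 <- N2 -> N3 <- N4 -> N5.  Let K = N2 x_(N3) N4, and let K1, K5 be the
   subspaces of pairs (a, b) of K such that a vanishes in N1, resp. b vanishes in N5.
   The multiplicity in N of the thin representation Z = (1,1,1,1,1) is
   dim K / (K1 + K5): this number is additive, equals 1 on Z, and an element of K
   outside K1 + K5 spans a copy of Z that splits off, so it vanishes on every other
   indecomposable.  Its value is an alternating sum of the dimensions of K, K1, K5 and
   K1 n K5, which are the Hom-spaces into N from the terms of the almost split sequence
   starting at Z.  Each of them, as a functor of M, is represented by a direct sum of
   interval modules, hence is exact on interval resolutions; the multiplicity is then the
   alternating sum of its values on the terms, and its value on V_J is 1 if I is
   contained in J and 0 otherwise. *)
From HB Require Import structures.
Require Import Defs.
From mathcomp Require Import all_boot all_order all_algebra.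
From mathcomp Require Import boolp classical_sets zify ring.

Set Implicit Arguments.
Unset Strict Implicit.
Unset Printing Implicit Defensive.

Import Order.TTheory GRing.Theory.
Local Open Scope ring_scope.

(** * Morphisms, retracts and direct sums of quiver representations *)

Section RepCategory.
Variables (k : fieldType) (Q : quiver).
Implicit Types N X Y : rep k Q.

Lemma rhom_natE N X (f : rhom N X) (a b : Q) (e : arrow a b) v :
  f b (rep_map N e v) = rep_map X e (f a v).
Proof. by rewrite -!comp_lfunE rhom_nat. Qed.

Fact rid_nat N (a b : Q) (e : arrow a b) :
  (\1 \o rep_map N e)%VF = (rep_map N e \o \1)%VF.
Proof. by rewrite comp_lfun1l comp_lfun1r. Qed.

Definition rid N : rhom N N := RHom (@rid_nat N).

Fact rcomp_nat N X Y (g : rhom X Y) (f : rhom N X) (a b : Q) (e : arrow a b) :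
  ((g b \o f b) \o rep_map N e)%VF = (rep_map Y e \o (g a \o f a))%VF.
Proof. by rewrite -comp_lfunA rhom_nat !comp_lfunA rhom_nat. Qed.

Definition rcomp N X Y (g : rhom X Y) (f : rhom N X) : rhom N Y :=
  @RHom _ _ N Y (fun a => (g a \o f a)%VF) (rcomp_nat g f).

Lemma iso_sym N X : iso N X -> iso X N.
Proof. by move=> [f [g fg]]; exists g, f => a; have [] := fg a. Qed.

(** The pointwise inverses are natural: compose the naturality squares of [f] with them on both
    sides. *)
Lemma rhom_bijective_iso N X (f : rhom N X) : (forall a, injective (f a)) ->
  (forall a v, exists u, v = f a u) -> iso N X.
Proof.
move=> f_inj f_surj.
have fK a : ((f a)^-1 \o f a)%VF = \1%VF by apply/lker0_compVf/lker0P/f_inj.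
have gK a : (f a \o (f a)^-1)%VF = \1%VF.
  apply/lfunP => v; rewrite comp_lfunE id_lfunE; case: (f_surj a v) => u ->.
  by rewrite limg_lfunVK ?memv_img ?memvf.
have g_nat (a b : Q) (e : arrow a b) :
    ((f b)^-1 \o rep_map X e)%VF = (rep_map N e \o (f a)^-1)%VF.
  rewrite -[rep_map X e]comp_lfun1r -(gK a) (comp_lfunA (rep_map X e)) -rhom_nat.
  by rewrite !comp_lfunA fK comp_lfun1l.
by exists f, (@RHom _ _ X N (fun a => (f a)^-1%VF) g_nat) => a; rewrite /= fK gK.
Qed.

Lemma iso_trans N X Y : iso N X -> iso X Y -> iso N Y.
Proof.
move=> [f [g fg]] [f' [g' fg']]; exists (rcomp f' f), (rcomp g g') => a /=.
have [gf fgE] := fg a; have [gf' fgE'] := fg' a; split.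
  by rewrite comp_lfunA -(comp_lfunA (g a)) gf' comp_lfun1r.
by rewrite comp_lfunA -(comp_lfunA (f' a)) fgE comp_lfun1r.
Qed.

Lemma iso_dsum N X : iso N X -> is_dsum (fun _ : unit => N) X.
Proof.
move=> [f [g fg]]; exists (fun=> f), (fun=> g); split.
- by move=> t a; have [] := fg a.
- by move=> [] [].
- by move=> a; rewrite (big_pred1 tt) => [|[]] //; have [] := fg a.
Qed.

(** Injections and projections compose through the two levels. This assembles a decomposition into
    indecomposables from decompositions of two smaller summands. *)
Lemma dsum_comp (T : finType) (S : T -> finType) (E : T -> rep k Q)
    (E' : forall t, S t -> rep k Q) N :
  is_dsum E N -> (forall t, is_dsum (E' t) (E t)) ->
  is_dsum (fun u : {t : T & S t} => E' (tag u) (tagged u)) N.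
Proof.
move=> [inj [prj [injK inj0 injS]]] dE'.
(* [cid] turns existence into data, so that biproduct maps are fixed for all [t] at once. *)
have {}dE' t : {ip : (forall s, rhom (E' t s) (E t)) *
                     (forall s, rhom (E t) (E' t s)) |
    [/\ forall s a, (ip.2 s a \o ip.1 s a)%VF = \1%VF,
        forall s s' a, s != s' -> (ip.2 s' a \o ip.1 s a)%VF = 0
      & forall a, \sum_s (ip.1 s a \o ip.2 s a)%VF = \1%VF]}.
  by apply: cid; have [i [p ip]] := dE' t; exists (i, p).
pose inj' t := (sval (dE' t)).1; pose prj' t := (sval (dE' t)).2.
exists (fun u => rcomp (inj (tag u)) (inj' (tag u) (tagged u))),
  (fun u => rcomp (prj' (tag u) (tagged u)) (prj (tag u))).
split=> [[t s] a|[t s] [t' s'] a|a] /=.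
- have [P1 _ _] := svalP (dE' t).
  by rewrite comp_lfunA -(comp_lfunA _ (prj t a)) injK comp_lfun1r P1.
(* Different [t] are orthogonal at the outer level. For equal ones the equality is eliminated first,
   because the types of [s] and [s'] depend on it. *)
- have [ett|ntt _] := eqVneq t t'; last first.
    by rewrite comp_lfunA -(comp_lfunA _ (prj t' a)) inj0 // comp_lfun0r comp_lfun0l.
  case: t' / ett s' => s' ne.
  have [_ P2 _] := svalP (dE' t).
  rewrite comp_lfunA -(comp_lfunA _ (prj t a)) injK comp_lfun1r P2 //.
  by apply: contraNneq ne => ->.
rewrite -(injS a); symmetry.
transitivity (\sum_t \sum_(s : S t)
    ((inj t a \o inj' t s a) \o (prj' t s a \o prj t a))%VF); last exact: sig_big_dep.
apply: eq_bigr => t _; have [_ _ P3] := svalP (dE' t).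
apply/lfunP => v; rewrite comp_lfunE -[prj t a v]id_lfunE -P3 !sum_lfunE linear_sum.
by apply: eq_bigr => s _; rewrite !comp_lfunE.
Qed.

Section Subrep.
Variables (N : rep k Q) (U : forall a : Q, {vspace N a}).
Hypothesis U_stable : forall (a b : Q) (e : arrow a b) v,
  v \in U a -> rep_map N e v \in U b.

Definition subrep : rep k Q :=
  @Rep k Q (fun a => subvs_of (U a)) (fun a b e =>
    (linfun (vsproj (U b)) \o rep_map N e \o linfun (@vsval _ _ (U a)))%VF).

Lemma subrep_mapE (a b : Q) (e : arrow a b) (v : subrep a) :
  vsval (rep_map subrep e v) = rep_map N e (vsval v).
Proof.
by rewrite !comp_lfunE !lfunE /= vsprojK // U_stable // subvsP.
Qed.

Fact subrep_incl_nat (a b : Q) (e : arrow a b) :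
  (linfun (@vsval _ _ (U b)) \o rep_map subrep e)%VF
    = (rep_map N e \o linfun (@vsval _ _ (U a)))%VF.
Proof.
apply/lfunP => v; rewrite [LHS]comp_lfunE [RHS]comp_lfunE.
by rewrite [LHS]lfunE [in RHS]lfunE; exact: subrep_mapE.
Qed.

Definition subrep_incl : rhom subrep N := RHom subrep_incl_nat.

Variables (f : rhom N N) (fU : forall a v, f a v \in U a).

Fact subrep_corestr_nat (a b : Q) (e : arrow a b) :
  ((linfun (vsproj (U b)) \o f b) \o rep_map N e)%VF
    = (rep_map subrep e \o (linfun (vsproj (U a)) \o f a))%VF.
Proof.
apply/lfunP => v; rewrite [LHS]comp_lfunE [RHS]comp_lfunE; apply: val_inj.
by rewrite [RHS]subrep_mapE !comp_lfunE !lfunE /= !vsprojK ?fU // rhom_natE.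
Qed.

Definition subrep_corestr : rhom N subrep := 
  @RHom _ _ N subrep (fun a => linfun (vsproj (U a)) \o f a)%VF subrep_corestr_nat.

End Subrep.

Fact rsub_nat N X (f g : rhom N X) (a b : Q) (e : arrow a b) :
  ((f b - g b) \o rep_map N e)%VF = (rep_map X e \o (f a - g a))%VF.
Proof.
by apply/lfunP => v; rewrite !(comp_lfunE, add_lfunE, opp_lfunE) !rhom_natE linearB.
Qed.

Definition rsub N X (f g : rhom N X) : rhom N X :=
  @RHom _ _ N X (fun a => f a - g a) (rsub_nat f g).

(** The complement is the kernel of [p], and the projection onto it is [1 - ip]. *)
Lemma retract_dsum N C (i : rhom C N) (p : rhom N C) :
  (forall a, (p a \o i a)%VF = \1%VF) ->
  exists D, is_dsum (fun b : bool => if b then C else D) N.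
Proof.
move=> piK; pose U a := lker (p a).
have Us (a b : Q) (e : arrow a b) v : v \in U a -> rep_map N e v \in U b.
  by rewrite !memv_ker rhom_natE => /eqP ->; rewrite linear0.
have piE a v : p a (i a v) = v by rewrite -comp_lfunE piK id_lfunE.
have eU a v : rsub (rid N) (rcomp i p) a v \in U a.
  rewrite memv_ker /= add_lfunE opp_lfunE id_lfunE comp_lfunE linearB /=.
  by rewrite piE subrr.
pose q : rhom N (subrep U) := subrep_corestr Us eU.
pose j : rhom (subrep U) N := subrep_incl Us.
have jE a v : j a v = vsval v by rewrite lfunE.
have qE a v : vsval (q a v) = v - i a (p a v).
  rewrite comp_lfunE lfunE /= vsprojK; last exact: eU.
  by rewrite add_lfunE opp_lfunE id_lfunE comp_lfunE.
have pj a (v : subvs_of (U a)) : p a (vsval v) = 0 :> C a.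
  by apply/eqP; rewrite -memv_ker; exact: subvsP.
exists (subrep U); pose E b := if b then C else subrep U.
exists (fun b => match b return rhom (E b) N with true => i | false => j end).
exists (fun b => match b return rhom N (E b) with true => p | false => q end).
split=> [[] a|[] [] a //= _|a].
- exact: piK.
- apply/lfunP => v; rewrite comp_lfunE id_lfunE; apply: val_inj.
  by apply: etrans (qE a (j a v)) _; rewrite jE pj linear0 subr0.
- apply/lfunP => v; rewrite comp_lfunE zero_lfunE; apply: val_inj.
  by apply: etrans (qE a (i a v)) _; rewrite piE subrr.
- by apply/lfunP => v; rewrite comp_lfunE zero_lfunE jE pj.
apply/lfunP => v; transitivity (i a (p a v) + j a (q a v)).
  by rewrite big_bool add_lfunE !comp_lfunE.
by rewrite [X in _ + X](etrans (jE a _) (qE a v)) id_lfunE addrC subrK.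
Qed.

Lemma is_zeroP N : is_zero N -> forall a (v : N a), v = 0.
Proof.
move=> N0 a v; apply/eqP; rewrite -memv0.
have /eqP := N0 a; rewrite dimv_eq0 => /eqP <-; exact: memvf.
Qed.

Lemma dsum_bool_iso (E : bool -> rep k Q) N :
  is_dsum E N -> is_zero (E false) -> iso N (E true).
Proof.
move=> [inj [prj [injK inj0 injS]]] /is_zeroP z.
exists (prj true), (inj true) => a; split; last exact: injK.
rewrite -(injS a) big_bool /=; apply/lfunP => v.
by rewrite add_lfunE !comp_lfunE [prj false a v]z linear0 addr0.
Qed.

(** One of [C] and its complement must vanish; it is not [C], so [C] is all of [N]. *)
Lemma indecomposable_retract N C (i : rhom C N) (p : rhom N C) :
  indecomposable N -> ~ is_zero C -> (forall a, (p a \o i a)%VF = \1%VF) ->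
  iso N C.
Proof.
move=> [_ indN] nzC /retract_dsum[D dD].
by case: (indN _ dD) => //= zD; exact: dsum_bool_iso dD zD.
Qed.

End RepCategory.

(** * Linear algebra: dimensions along biproducts, separating functionals *)

Lemma dim_biproduct (k : fieldType) (T : finType) (V : T -> vectType k) (W : vectType k)
    (inj : forall t, 'Hom(V t, W)) (prj : forall t, 'Hom(W, V t))
    (A : forall t, {vspace V t}) (B : {vspace W}) :
    (forall t v, prj t (inj t v) = v) ->
    (forall s t v, s != t -> prj t (inj s v) = 0) ->
    (forall w, \sum_t inj t (prj t w) = w) ->
    (forall t v, v \in A t -> inj t v \in B) ->
    (forall t w, w \in B -> prj t w \in A t) ->
  \dim B = (\sum_t \dim (A t))%N.
Proof.
(* [B] is the internal direct sum of the images of the [A t]: the projections carry [B] back into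
   the [A t], and they also detect independence. *)
move=> injK inj0 injS injA prjB; pose U t := (inj t @: A t)%VS.
have -> : B = (\sum_t U t)%VS.
  apply/eqP; rewrite eqEsubv; apply/andP; split; last first.
    by apply/subv_sumP => t _; apply/subvP => _ /memv_imgP[v vA ->]; apply: injA.
  apply/subvP => w wB; rewrite -(injS w).
  by apply: memv_sumr => t _; rewrite memv_img ?prjB.
have /directvP -> : directv (\sum_t U t).
  apply/directv_sum_independent => us usU us0 t _.
  have {}usU s : {v | us s = inj s v}.
    by apply: cid; case/memv_imgP: (usU s isT) => v _ ->; exists v.
  have /(congr1 (prj t)) := us0.
  rewrite linear_sum linear0 (bigD1 t) //= big1 => [|s st].
    by case: (usU t) => v ->; rewrite addr0 injK => ->; rewrite linear0.
  by case: (usU s) => v ->; rewrite inj0.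
apply: eq_bigr => t _; apply: limg_dim_eq; apply/eqP; rewrite -subv0.
apply/subvP => v /memv_capP[_]; rewrite memv_ker memv0 => /eqP e.
by rewrite -(injK t v) e linear0.
Qed.

Section Functionals.
Variables (k : fieldType) (V : vectType k).

Definition line_fun (v : V) (c : k^o) : V := (c : k) *: v.

Fact line_fun_linear v : linear (line_fun v).
Proof. by move=> a x y; rewrite /line_fun scalerDl scalerA. Qed.

HB.instance Definition _ v := GRing.isLinear.Build k k^o V _ (line_fun v) (line_fun_linear v).

(** A vector seen as a map out of the one-dimensional space [k^o]; morphisms out of the thin
    representation are built from such maps. *)
Definition line (v : V) : 'Hom(k^o, V) := linfun (line_fun v).

Lemma lineE v (c : k^o) : line v c = (c : k) *: v.
Proof. by rewrite lfunE. Qed.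

(** Project along [L], then read off the coordinate on the line spanned by the nonzero image of
    [w]. *)
Lemma linear_functional (L : {vspace V}) (w : V) :
  w \notin L -> exists2 phi : 'Hom(V, k^o), phi w = 1 & forall x, x \in L -> phi x = 0.
Proof.
move=> wL; pose q : 'End(V) := (\1 - projv L)%VF.
have q0 x : (q x == 0) = (x \in L).
  rewrite add_lfunE opp_lfunE id_lfunE subr_eq0.
  apply/eqP/idP => [->|/projv_id -> //]; exact: memv_proj.
pose l := line (q w).
have lK : (l^-1 \o l = \1)%VF.
  apply: lker0_compVf; apply/lker0P => a b; rewrite !lineE => /eqP.
  rewrite -subr_eq0 -scalerBl scaler_eq0 q0 (negPf wL) orbF subr_eq0 => /eqP //.
exists (l^-1 \o q)%VF; last by move=> x; rewrite -q0 comp_lfunE => /eqP ->; rewrite linear0.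
rewrite comp_lfunE -[q w]scale1r; transitivity (l^-1%VF (l 1)); first by rewrite lineE.
by rewrite -comp_lfunE lK id_lfunE.
Qed.

(** The partial inverse [f^-1] sends [f x] to a vector that differs from [x] by an element of the
    kernel of [f], which [phi] does not see. *)
Lemma functional_factor (W : vectType k) (f : 'Hom(V, W)) (phi : 'Hom(V, k^o)) :
  (forall x, f x = 0 -> phi x = 0) -> exists psi : 'Hom(W, k^o), (psi \o f)%VF = phi.
Proof.
move=> fphi; exists (phi \o f^-1)%VF; apply/lfunP => x; rewrite !comp_lfunE.
apply/eqP; rewrite -subr_eq0 -linearB; apply/eqP/fphi.
by rewrite linearB /= limg_lfunVK ?subrr // memv_img ?memvf.
Qed.

End Functionals.

(** * Representations of the zigzag and the multiplicity of the thin one *)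

Section Zigzag.
Variable k : fieldType.
Implicit Types (N X Y : rep k zigzag) (c d : bool).

Definition pairs N : vectType k := (N v2 * N v4)%type.

(* For [c = d = false] this is the pullback [N v2 x_(N v3) N v4], that is, Hom(Z, N)
   with Z the thin representation 1-1-1-1-1.  Setting [c] (resp. [d]) replaces Z by
   its quotient vanishing at v1 (resp. v5). *)
Definition gluing c d N : {vspace pairs N} :=
  (lker ((rep_map N alpha2 \o linfun fst) - (rep_map N alpha3 \o linfun snd))%VF
   :&: (if c then lker (rep_map N alpha1 \o linfun fst)%VF else fullv)
   :&: (if d then lker (rep_map N alpha4 \o linfun snd)%VF else fullv))%VS.

Lemma mem_gluing c d N (v : pairs N) :
  (v \in gluing c d N) =
    [&& rep_map N alpha2 v.1 == rep_map N alpha3 v.2,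
        c ==> (rep_map N alpha1 v.1 == 0) & d ==> (rep_map N alpha4 v.2 == 0)].
Proof.
rewrite !memv_cap memv_ker add_lfunE opp_lfunE !comp_lfunE !lfunE subr_eq0 -andbA.
by congr [&& _, _ & _]; [case: c | case: d];
  rewrite /= ?memvf // memv_ker !comp_lfunE !lfunE.
Qed.

Definition pairs_fun N X (f : rhom N X) (v : pairs N) : pairs X :=
  (f v2 v.1, f v4 v.2).

Fact pairs_fun_linear N X (f : rhom N X) : linear (pairs_fun f).
Proof. by move=> a u v; congr (_, _); rewrite linearP. Qed.

HB.instance Definition _ N X (f : rhom N X) :=
  GRing.isLinear.Build k (pairs N) (pairs X) _ (pairs_fun f) (pairs_fun_linear f).

Definition pairs_map N X (f : rhom N X) : 'Hom(pairs N, pairs X) :=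
  linfun (pairs_fun f).

Lemma pairs_mapE N X (f : rhom N X) v : pairs_map f v = (f v2 v.1, f v4 v.2).
Proof. by rewrite lfunE. Qed.

Lemma pairs_map_gluing c d N X (f : rhom N X) v :
  v \in gluing c d N -> pairs_map f v \in gluing c d X.
Proof.
rewrite !mem_gluing pairs_mapE /= -!rhom_natE.
case/and3P=> /eqP -> N1 N4; rewrite eqxx /=.
by apply/andP; split; apply/implyP; [move/(implyP N1)|move/(implyP N4)] => /eqP ->;
  rewrite linear0.
Qed.

Lemma dim_gluing_dsum (T : finType) (E : T -> rep k zigzag) N c d :
  is_dsum E N -> \dim (gluing c d N) = (\sum_t \dim (gluing c d (E t)))%N.
Proof.
move=> [inj [prj [injK inj0 injS]]].
apply: (@dim_biproduct _ T (fun t => pairs (E t)) _ (fun t => pairs_map (inj t))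
          (fun t => pairs_map (prj t))) => [t v|s t v st|v|t v|t v].
- by rewrite !pairs_mapE /= -!comp_lfunE !injK !id_lfunE -surjective_pairing.
- by rewrite !pairs_mapE /= -!comp_lfunE !inj0 // !zero_lfunE.
- rewrite [RHS]surjective_pairing -[v.1]id_lfunE -[v.2]id_lfunE -!injS.
  rewrite !sum_lfunE [LHS]surjective_pairing.
  rewrite !(raddf_sum (@fst (N v2) (N v4))) !(raddf_sum (@snd (N v2) (N v4))) /=.
  by congr (_, _); apply: eq_bigr => t _; rewrite !pairs_mapE comp_lfunE.
- exact: pairs_map_gluing.
- exact: pairs_map_gluing.
Qed.

(** As a Hom functor, [gluing c d] is left exact, so only surjectivity onto the gluing space of [Y]
    has to be assumed; the rest is rank-nullity for [pairs_map p]. *)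
Lemma dim_gluing_exact N X Y (i : rhom N X) (p : rhom X Y) c d :
    (forall a, injective (i a)) -> (forall a, limg (i a) = lker (p a)) ->
    (forall w, w \in gluing c d Y ->
       exists2 v, v \in gluing c d X & pairs_map p v = w) ->
  \dim (gluing c d X) = (\dim (gluing c d N) + \dim (gluing c d Y))%N.
Proof.
move=> i_inj ip p_surj; rewrite -(limg_ker_dim (pairs_map p) (gluing c d X)).
congr (_ + _)%N; last first.
  congr (\dim _); apply/eqP; rewrite eqEsubv; apply/andP; split; apply/subvP => w.
    by case/memv_imgP=> v vX ->; apply: pairs_map_gluing.
  by case/p_surj => v vX <-; apply: memv_img.
have piE a v : p a (i a v) = 0.
  by apply/eqP; rewrite -memv_ker -ip memv_img ?memvf.
transitivity (\dim (pairs_map i @: gluing c d N)); last first.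
  apply: limg_dim_eq; apply/eqP; rewrite -subv0.
  apply/subvP => v /memv_capP[_]; rewrite memv_ker pairs_mapE memv0 => /eqP[e1 e2].
  rewrite [v]surjective_pairing.
  by apply/eqP; congr (_, _); apply: i_inj; rewrite linear0.
congr (\dim _); apply/eqP; rewrite eqEsubv; apply/andP; split; apply/subvP => v.
  case/memv_capP=> vX; rewrite memv_ker pairs_mapE => /eqP[e1 e2].
  have /memv_imgP[u1 _ E1] : v.1 \in limg (i v2) by rewrite ip memv_ker e1.
  have /memv_imgP[u2 _ E2] : v.2 \in limg (i v4) by rewrite ip memv_ker e2.
  apply/memv_imgP; exists (u1, u2); last first.
    by rewrite pairs_mapE /= -E1 -E2 -surjective_pairing.
  (* Injectivity of [i] at [v3], [v1] and [v5] reflects the three gluing conditions from [X] back to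
     [N]. *)
  move: vX; rewrite !mem_gluing E1 E2 -!rhom_natE /= => /and3P[/eqP/i_inj -> c0 d0].
  rewrite eqxx /=; apply/andP; split; apply/implyP.
    move=> /(implyP c0)/eqP e.
    by apply/eqP/(i_inj v1); rewrite e linear0.
  move=> /(implyP d0)/eqP e.
  by apply/eqP/(i_inj v5); rewrite e linear0.
case/memv_imgP=> u uN ->; apply/memv_capP; split; first exact: pairs_map_gluing.
by rewrite memv_ker !pairs_mapE /= !piE.
Qed.

Definition full_mult N : nat :=
  (\dim (gluing false false N) - \dim (gluing true false N + gluing false true N))%N.

(** Inclusion-exclusion: the two subspaces meet in [gluing true true N]. The truncated subtraction
    is harmless because their sum lies in [gluing false false N]. In this form additivity and
    exactness can be checked term by term. *)
Lemma full_multE N : (full_mult N)%:Z =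
  (\dim (gluing false false N))%:Z - (\dim (gluing true false N))%:Z
  - (\dim (gluing false true N))%:Z + (\dim (gluing true true N))%:Z.
Proof.
rewrite /full_mult -subzn; last first.
  apply: dimvS; rewrite subv_add; apply/andP; split; apply/subvP => v;
  by rewrite !mem_gluing => /and3P[->].
have := dimv_sum_cap (gluing true false N) (gluing false true N).
have -> : (gluing true false N :&: gluing false true N)%VS = gluing true true N.
  by apply/vspaceP => v; rewrite memv_cap !mem_gluing /= andbT; do !case: eqP.
by lia.
Qed.

Lemma full_mult_dsum (T : finType) (E : T -> rep k zigzag) N :
  is_dsum E N -> full_mult N = (\sum_t full_mult (E t))%N.
Proof.
move=> dE; apply/eqP; rewrite -eqz_nat full_multE !(dim_gluing_dsum _ _ dE).
rewrite !(big_morph Posz PoszD (erefl _)) -!sumrB -big_split /=.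
by apply/eqP; apply: eq_bigr => t _; rewrite full_multE.
Qed.

Lemma full_mult_iso N X : iso N X -> full_mult N = full_mult X.
Proof. by move=> /iso_dsum/full_mult_dsum ->; rewrite big_const card_unit /= addn0. Qed.

Definition thin : rep k zigzag :=
  @Rep k zigzag (fun=> k^o : vectType k) (fun _ _ _ => \1%VF).

Lemma thin_neq0 : ~ is_zero thin.
Proof. by move/is_zeroP/(_ v1 (1 : k^o))/eqP; rewrite oner_eq0. Qed.

Lemma full_mult_thin : full_mult thin = 1%N.
Proof.
rewrite /full_mult.
have -> : gluing true false thin = 0%VS.
  apply/eqP; rewrite -subv0; apply/subvP => -[a b].
  rewrite mem_gluing /= !id_lfunE memv0 => /and3P[/eqP <- /eqP -> _]; exact: eqxx.
have -> : gluing false true thin = 0%VS.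
  apply/eqP; rewrite -subv0; apply/subvP => -[a b].
  rewrite mem_gluing /= !id_lfunE memv0 => /andP[/eqP -> /eqP ->]; exact: eqxx.
rewrite addv0 dimv0 subn0.
have -> : gluing false false thin = <[ (1, 1) : pairs thin ]>%VS.
  apply/vspaceP => -[a b]; rewrite mem_gluing /= !id_lfunE andbT.
  apply/eqP/vlineP => [->|[c [-> ->]] //]; exists b.
  by congr (_, _); rewrite /= /GRing.scale /= mulr1.
by rewrite dim_vline -pair_eqE /= oner_eq0.
Qed.

(** A pair [(a, b)] outside the sum of the two subspaces defines [i]. A functional at [v3] that is 1
    on the common image of [a] and [b] and kills [L] extends along the zigzag to [p]. *)
Lemma full_mult_retract N : (0 < full_mult N)%N ->
  exists (i : rhom thin N) (p : rhom N thin), forall a, (p a \o i a)%VF = \1%VF.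
Proof.
pose L := (rep_map N alpha2 @: lker (rep_map N alpha1) +
           rep_map N alpha3 @: lker (rep_map N alpha4))%VS.
rewrite /full_mult subn_gt0 => lt.
have /subvPn[[a b] abK abL] :
    ~~ (gluing false false N <= gluing true false N + gluing false true N)%VS.
  by apply: contraL lt => /dimvS; rewrite -leqNgt.
move: abK; rewrite mem_gluing /= andbT => /eqP ab.
(* If the image of [a] were [alpha2 u + alpha3 w] with [u], [w] killed at the ends, then
   [(u, b - w)] and [(a - u, w)] would split [(a, b)]. *)
have aL : rep_map N alpha2 a \notin L.
  apply: contraNN abL => /memv_addP[_ /memv_imgP[u u1 ->] [_ /memv_imgP[w w5 ->]]] e.
  rewrite !memv_ker in u1 w5.
  have -> : (a, b) = (u, b - w) + (a - u, w) :> pairs N.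
    by congr (_, _); rewrite /= ?subrK // addrC subrK.
  apply: memv_add; rewrite mem_gluing /=.
    by rewrite u1 andbT linearB /= -ab e addrK eqxx.
  by rewrite w5 andbT linearB /= e addrAC subrr add0r eqxx.
have [phi phia phiL] := linear_functional aL.
pose phi2 := (phi \o rep_map N alpha2)%VF; pose phi4 := (phi \o rep_map N alpha3)%VF.
(* Vanishing on [L] is exactly what lets the functionals at [v2] and [v4] factor through the outer
   arrows. *)
have [phi1 phi1E] : exists psi, (psi \o rep_map N alpha1)%VF = phi2.
  apply: functional_factor => x x0; rewrite comp_lfunE phiL //.
  by rewrite (subvP (addvSl _ _)) // memv_img // memv_ker x0.
have [phi5 phi5E] : exists psi, (psi \o rep_map N alpha4)%VF = phi4.
  apply: functional_factor => x x0; rewrite comp_lfunE phiL //.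
  by rewrite (subvP (addvSr _ _)) // memv_img // memv_ker x0.
pose pt (x : zvertex) : N x := match x return N x with
  | v1 => rep_map N alpha1 a | v2 => a | v3 => rep_map N alpha2 a
  | v4 => b | v5 => rep_map N alpha4 b end.
pose fn (x : zvertex) : 'Hom(N x, k^o) := match x return 'Hom(N x, k^o) with
  | v1 => phi1 | v2 => phi2 | v3 => phi | v4 => phi4 | v5 => phi5 end.
have iP (x y : zvertex) (e : zarrow x y) :
    (line (pt y) \o rep_map thin e)%VF = (@rep_map _ _ N x y e \o line (pt x))%VF.
  apply/lfunP => c; rewrite !comp_lfunE id_lfunE !lineE linearZ /=.
  by case: e => //=; rewrite -ab.
have pP (x y : zvertex) (e : zarrow x y) :
    (fn y \o @rep_map _ _ N x y e)%VF = (@rep_map _ _ thin x y e \o fn x)%VF.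
  by rewrite comp_lfun1l; case: e.
exists (@RHom _ _ thin N (fun x => line (pt x)) iP), (@RHom _ _ N thin fn pP) => x.
apply/lfunP => c; rewrite comp_lfunE id_lfunE /= lineE linearZ /=.
suff -> : fn x (pt x) = 1 by rewrite /GRing.scale /= mulr1.
by case: x => /=; rewrite ?comp_lfunE // -?ab //;
  rewrite -comp_lfunE ?phi1E ?phi5E comp_lfunE // -ab.
Qed.

(** A positive value makes [thin] a retract of [N], hence isomorphic to [N]. *)
Lemma full_mult_indecomposable N : indecomposable N ->
  full_mult N = `[< iso N thin >] :> nat.
Proof.
move=> indN; case: asboolP => [/full_mult_iso ->|nN]; first exact: full_mult_thin.
apply/eqP; rewrite -leqn0 leqNgt; apply/negP => /full_mult_retract[i [p pi]].
by apply: nN; apply: indecomposable_retract indN thin_neq0 pi.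
Qed.

Definition total_dim N : nat :=
  (\dim {: N v1} + \dim {: N v2} + \dim {: N v3} + \dim {: N v4} + \dim {: N v5})%N.

Lemma total_dim_eq0 N : total_dim N = 0%N -> is_zero N.
Proof. by rewrite /total_dim => N0; case; lia. Qed.

Lemma dsum_dim (T : finType) (E : T -> rep k zigzag) N (x : zvertex) : is_dsum E N ->
  \dim {: N x} = (\sum_t \dim {: E t x})%N.
Proof.
move=> [inj [prj [injK inj0 injS]]].
apply: (@dim_biproduct _ T (fun t => E t x) _ (fun t => inj t x) (fun t => prj t x))
  => [t v|s t v st|v|t v|t v]; rewrite ?memvf //.
- by rewrite -comp_lfunE injK id_lfunE.
- by rewrite -comp_lfunE inj0 // zero_lfunE.
- rewrite -[RHS]id_lfunE -injS sum_lfunE.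
  by apply: eq_bigr => t _; rewrite comp_lfunE.
Qed.

(** Existence half of Krull-Schmidt, by induction on the total dimension. *)
Lemma indecomposable_dsum_exists N : exists (T : finType) (E : T -> rep k zigzag),
  (forall t, indecomposable (E t)) /\ is_dsum E N.
Proof.
have [m] := ubnP (total_dim N); elim: m N => // m IH N Nm.
have [N0|nN0] := pselect (is_zero N).
  exists void, (fun t : void => match t with end); split=> [[]|].
  exists (fun t : void => match t with end), (fun t : void => match t with end).
  split=> [[]|[]|a].
  by apply/lfunP => v; rewrite (is_zeroP N0 v) !linear0.
have [indN|nindN] := pselect (indecomposable N).
  exists unit, (fun=> N); split=> //; apply: iso_dsum.
  by exists (rid N), (rid N) => a; rewrite /= comp_lfun1l.
have [E dE nE] : exists2 E : bool -> rep k zigzag, is_dsum E N &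
    ~ (is_zero (E false) \/ is_zero (E true)).
  apply: contrapT => H; apply: nindN; split=> // E dE.
  by apply: contrapT => nz; apply: H; exists E.
have dim_E : total_dim N = (total_dim (E true) + total_dim (E false))%N.
  by rewrite /total_dim !(dsum_dim _ dE) !big_bool /=; lia.
have Epos b : (0 < total_dim (E b))%N.
  by rewrite lt0n; apply/eqP => /total_dim_eq0 z; case: nE; case: b z; [right|left].
have {}IH b : exists TE : {T : finType & T -> rep k zigzag},
    (forall t, indecomposable (tagged TE t)) /\ is_dsum (tagged TE) (E b).
  have [|T [F FP]] := IH (E b); last first.
    by exists (Tagged (fun T : finType => T -> rep k zigzag) F).
  (* The other summand has positive dimension, so [E b] is strictly smaller than [N]. *)
  by have := Epos (~~ b); case: b; rewrite /=; lia.
have [TE TEP] := choice IH.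
exists {b : bool & tag (TE b)}, (fun u => tagged (TE (tag u)) (tagged u)).
split=> [u|]; first by have [] := TEP (tag u).
apply: (@dsum_comp _ _ _ (fun b => tag (TE b)) _ (fun b => tagged (TE b)) _ dE) => b.
by have [] := TEP b.
Qed.

(** By additivity, [full_mult N] counts the summands isomorphic to [Z] in every decomposition into
    indecomposables. Such a decomposition exists, which excludes the default value of [xget]. *)
Lemma multiplicity_thin (Z : rep k zigzag) N : iso Z thin -> multiplicity Z N = full_mult N.
Proof.
move=> ZT.
have uniq_mult m : is_multiplicity Z N m -> m = full_mult N.
  move=> [T [E [indE dE <-]]]; rewrite (full_mult_dsum dE) -sum1dep_card big_mkcond /=.
  apply: eq_bigr => t _; rewrite full_mult_indecomposable //.
  have -> : `[< iso (E t) thin >] = `[< iso (E t) Z >].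
    apply/asboolP/asboolP => h; apply: iso_trans h _; [exact: iso_sym | exact: ZT].
  by case: asboolP.
rewrite /multiplicity; case: xgetP => [m _ /uniq_mult //|no].
have [T [E [indE dE]]] := indecomposable_dsum_exists N.
by case: (no #|[set t | `[< iso (E t) Z >]]|); exists T, E.
Qed.

End Zigzag.

(** * Connected components of convex subsets of a poset *)

Section Components.
Variables (disp : Order.disp_t) (P : finPOrderType disp) (S : {set P}).
Hypothesis S_convex : forall p z q : P,
  p \in S -> q \in S -> (p <= z)%O -> (z <= q)%O -> z \in S.

Definition component (p : P) : {set P} := [set q in S | connect (hasse_adj S) p q].

Lemma hasse_adj_sym (C : {set P}) : symmetric (hasse_adj C).
Proof. by move=> p q; rewrite /hasse_adj /= andbCA orbC. Qed.

(** Induction on the size of the segment from [p] to [q]: unless [q] covers [p], a point strictly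
    between them lies in [S] by convexity and cuts off two smaller segments. *)
Lemma connect_le (p q : P) :
  p \in S -> q \in S -> (p <= q)%O -> connect (hasse_adj S) p q.
Proof.
have [m] := ubnP #|[set z | (p <= z <= q)%O]|; elim: m p q => // m IH p q lt pS qS pq.
have [-> //|npq] := eqVneq p q.
have {npq}pq : (p < q)%O by rewrite lt_neqAle npq.
have [cov|] := boolP (covers p q); first by apply: connect1; rewrite /hasse_adj /= pS qS cov.
rewrite /covers pq /= negbK => /existsP[z /andP[pz zq]].
have zS : z \in S by apply: S_convex pS qS _ _; exact: ltW.
apply: (connect_trans (y := z)); apply: IH => //; try exact: ltW.
  apply: leq_trans (proper_card _) lt; apply/properP; split.
    by apply/fintype.subsetP => x; rewrite !inE => /andP[-> /le_trans-> //]; exact: ltW.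
  by exists q; rewrite !inE ?lexx ?(ltW pq) //= lt_geF ?andbF.
apply: leq_trans (proper_card _) lt; apply/properP; split.
  by apply/fintype.subsetP => x; rewrite !inE => /andP[/(le_trans (ltW pz)) -> ->].
by exists p; rewrite !inE ?lexx ?(ltW pq) //= lt_geF.
Qed.

Lemma component_le p q : p \in S -> q \in S -> (p <= q)%O -> component p = component q.
Proof.
move=> pS qS pq; apply/setP => z; rewrite !inE; congr (_ && _).
apply: same_connect; last exact: connect_le.
exact: sym_connect_sym (@hasse_adj_sym S).
Qed.

Lemma component_mem p q : q \in component p -> component q = component p.
Proof.
rewrite inE => /andP[qS pq]; apply/setP => z; rewrite !inE; congr (_ && _).
apply/esym; apply: same_connect => //; exact: sym_connect_sym (@hasse_adj_sym S).
Qed.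

Lemma component_interval p : p \in S -> is_interval (component p).
Proof.
move=> pS; apply/and3P; split.
- by apply/set0Pn; exists p; rewrite inE pS connect0.
- apply/forall_inP => a aC; apply/forall_inP => b bC; apply/forallP => z.
  apply/implyP => /andP[az zb].
  have [aS bS] : a \in S /\ b \in S by move: aC bC; rewrite !inE => /andP[-> _] /andP[->].
  have zS := S_convex aS bS az zb.
  move: aC; rewrite !inE zS => /andP[_ /connect_trans->] //; exact: connect_le.
(* A path in [S] that starts at [p] never leaves the component, so it is also a path inside the
   component. *)
have key b : b \in component p -> connect (hasse_adj (component p)) p b.
  rewrite inE => /andP[_ /connectP[s sP ->]].
  elim/last_ind: s sP => //= s x IH; rewrite rcons_path last_rcons => /andP[ps e].
  apply: connect_trans (IH ps) (connect1 _); case/and3P: e => lS xS cov.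
  have pl : connect (hasse_adj S) p (last p s) by apply/connectP; exists s.
  rewrite /hasse_adj /= cov !inE lS xS pl /= andbT.
  by apply: connect_trans pl (connect1 _); rewrite /hasse_adj /= lS xS cov.
apply/forall_inP => a aC; apply/forall_inP => b bC.
apply: connect_trans (key b bC).
by rewrite (sym_connect_sym (@hasse_adj_sym _)); apply: key.
Qed.

End Components.

(** * Morphisms out of interval modules, and lifting of sections *)

Section Lifting.
Variables (disp : Order.disp_t) (P : finPOrderType disp) (k : fieldType).
Implicit Types M X : pmod P k.

(* On the up-set U, [s] is a compatible family vanishing on the up-set W, i.e. a
   morphism from the indicator module of U \ W. *)
Definition vanishing_section M (U W : {set P}) (s : forall p, M p) :=
  (forall (p q : poset_quiver P) (h : arrow p q), p \in U -> rep_map M h (s p) = s q) /\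
  (forall p, p \in W -> s p = 0).

Lemma int_decomposable_int (J : pinterval P) : int_decomposable (int_mod k J).
Proof.
exists unit, (fun=> J); apply: iso_dsum.
by exists (rid _), (rid _) => a; rewrite /= comp_lfun1l.
Qed.

(** The coordinate sum is the only coordinate for [p] in [J] and an empty sum otherwise, which
    treats both row lengths uniformly. *)
Definition int_eval_fun M (J : pinterval P) (s : forall p, M p) (p : P)
  (v : int_mod k J p) : M p := (\sum_i (v : 'rV_(p \in val J)) 0 i) *: s p.

Fact int_eval_linear M J s p : linear (@int_eval_fun M J s p).
Proof.
move=> a u v; rewrite /int_eval_fun scalerA -scalerDl mulr_sumr -big_split /=.
by congr (_ *: _); apply: eq_bigr => i _; rewrite !mxE.
Qed.

HB.instance Definition _ M J s p :=
  GRing.isLinear.Build k (int_mod k J p) (M p) _ (@int_eval_fun M J s p)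
    (@int_eval_linear M J s p).

Definition int_one (J : pinterval P) (p : P) : int_mod k J p :=
  (const_mx 1 : 'rV_(p \in val J)).

Lemma int_oneE (J : pinterval P) (p : P) (v : int_mod k J p) :
  v = (\sum_i (v : 'rV_(p \in val J)) 0 i) *: int_one J p.
Proof.
rewrite /int_one; move: v; rewrite /int_mod /= /int_sp.
case: (p \in val J) => v; apply/rowP => -[[|i] //= lt].
by rewrite big_ord1 !mxE mulr1; congr (v _ _); apply: val_inj.
Qed.

Lemma int_map_one (J : pinterval P) (p q : poset_quiver P) (h : arrow p q) :
  p \in val J -> rep_map (int_mod k J) h (int_one J p) = int_one J q.
Proof.
move=> pJ; rewrite lfunE /= /int_one; move: pJ; case: (p \in val J) => // _.
by apply/rowP => j; rewrite mxE big_ord1 !mxE mulr1.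
Qed.

Lemma int_one0 (J : pinterval P) (p : P) : p \notin val J -> int_one J p = 0.
Proof.
by rewrite /int_one => /negPf; rewrite /int_mod /= /int_sp => ->; apply/rowP => -[].
Qed.

Lemma int_one_neq0 (J : pinterval P) (p : P) : p \in val J -> int_one J p != 0.
Proof.
move=> pJ; apply/eqP => /(congr1 (fun v : 'rV[k]_(p \in val J) => \sum_i v 0 i)).
rewrite [RHS]big1 => [|i _]; last exact: mxE.
rewrite /int_one; move: pJ; case: (p \in val J) => // _ /eqP.
by rewrite big_ord1 mxE oner_eq0.
Qed.

Lemma int_one_eval M (J : pinterval P) (s : forall p, M p) p :
  p \in val J -> int_eval_fun s (int_one J p) = s p.
Proof.
rewrite /int_eval_fun /int_one; case: (p \in val J) => // _.
by rewrite big_ord1 mxE scale1r.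
Qed.

(** The vectors [int_one J p] span the spaces of [V_J], so naturality need only be checked on them;
    transport out of [J] must give zero. *)
Lemma int_hom M (J : pinterval P) (s : forall p, M p) :
    (forall (p q : poset_quiver P) (h : arrow p q), p \in val J ->
       rep_map M h (s p) = if q \in val J then s q else 0) ->
  exists g : rhom (int_mod k J) M, forall p, p \in val J -> g p (int_one J p) = s p.
Proof.
move=> sP; pose g (p : P) : 'Hom(int_mod k J p, M p) := linfun (@int_eval_fun M J s p).
have gE p v : g p v = int_eval_fun s v by rewrite lfunE.
have gP (p q : poset_quiver P) (h : arrow p q) :
    (g q \o rep_map (int_mod k J) h)%VF = (rep_map M h \o g p)%VF.
  apply/lfunP => v; rewrite [LHS]comp_lfunE [RHS]comp_lfunE [v]int_oneE !linearZ /=.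
  congr (_ *: _); have [pJ|pJ] := boolP (p \in val J); last first.
    by rewrite int_one0 // !linear0.
  transitivity (g q (int_one J q)); first by congr (g q _); exact: int_map_one.
  rewrite !gE (int_one_eval _ pJ) sP //.
  by case: ifPn => qJ; [rewrite int_one_eval | rewrite int_one0 // linear0].
by exists (@RHom _ _ (int_mod k J) M g gP) => p pJ; rewrite /= gE; exact: int_one_eval.
Qed.

(* A section splits into morphisms from the interval modules of the connected
   components of U \ W, each of which factors through the approximation. *)
Lemma lift_section X M (f : rhom X M) (U W : {set P}) (s : forall p, M p) :
    right_approx f ->
    (forall p q : P, (p <= q)%O -> p \in U -> q \in U) ->
    (forall p q : P, (p <= q)%O -> p \in W -> q \in W) ->
    vanishing_section U W s ->
  exists2 x : forall p, X p, vanishing_section U W x &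
    forall p, p \in U -> f p (x p) = s p.
Proof.
move=> [_ fP] upU upW [sU sW]; pose S := U :\: W.
have cS (p z q : P) : p \in S -> q \in S -> (p <= z)%O -> (z <= q)%O -> z \in S.
  rewrite !inE => /andP[_ pU] /andP[qW _] pz zq.
  by rewrite (upU _ _ pz pU) andbT; apply: contra qW; exact: upW.
(* The lift is chosen per component, not per point, so that it is the same at comparable points of
   [S]. *)
have /choice[y yP] (C : {set P}) : exists y : forall p, X p,
    forall p, p \in S -> C = component S p ->
    [/\ f p (y p) = s p,
        forall q (h : (p <= q)%O), rep_map X (h : @arrow (poset_quiver P) p q) (y p) = y q
      & forall q, q \in W -> y q = 0].
  have [[p0 p0S ->]|no] := pselect (exists2 p, p \in S & C = component S p); last first.
    by exists (fun=> 0) => p pS eC; case: no; exists p.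
  pose J : pinterval P := Sub (component S p0) (component_interval cS p0S).
  have JS p : p \in val J -> p \in S by rewrite /= inE => /andP[].
  have [p q h pJ|g gP] := @int_hom M J s.
    have pS := JS _ pJ; move: (pS); rewrite !inE => /andP[pW pU].
    (* A point of [S] above [p] lies in the same component. Leaving [J] upwards therefore means
       entering [W], where [s] vanishes. *)
    rewrite sU //; have [//|qJ] := ifPn; apply: sW; apply: contraNT qJ => qW.
    have qS : q \in S by rewrite !inE qW (upU _ _ h pU).
    suff : q \in component S p0 by rewrite !inE.
    by rewrite -(component_mem pJ) (component_le cS pS qS h) inE qS connect0.
  have [h hP] := fP _ g (int_decomposable_int J).
  exists (fun p => h p (int_one J p)) => p pS ep.
  have pJ : p \in val J by rewrite /= ep inE pS connect0.
  split=> [|q pq|q qW].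
  - by rewrite -gP // hP comp_lfunE.
  - by rewrite -rhom_natE int_map_one.
  - rewrite int_one0 ?linear0 //; apply/negP => /JS; by rewrite !inE qW.
exists (fun p => if p \in S then y (component S p) p else 0).
  split=> [p q h pU|p pW]; last by rewrite !inE pW.
  have [pS|pS] := ifPn.
    have [_ y1 y0] := yP _ p pS erefl; rewrite (y1 q h).
    have [qS|qS] := ifPn; first by rewrite (component_le cS pS qS h).
    by apply: y0; apply: contraNT qS => qW; rewrite !inE qW (upU _ _ h pU).
  rewrite linear0 ifN //; apply: contra pS; rewrite !inE pU andbT => /andP[qW _].
  by apply: contra qW; apply: upW h.
move=> p pU; have [pS|pS] := ifPn; first by have [] := yP _ p pS erefl.
by rewrite linear0 sW //; apply: contraNT pS => pW; rewrite !inE pW.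
Qed.

End Lifting.

(** * Compression of ladder modules and alternating sums over resolutions *)

Section LadderMultiplicity.
Variables (n : nat) (k : fieldType) (I : pinterval (ladder n)).
Implicit Types M X : pmod (ladder n) k.

(** If [I] meets both rows, [xi I v3] is the join of the other two points; otherwise all three
    coincide. This is why a pullback over [v3] describes sections. *)
Lemma xi_le_v3 (p : ladder n) :
  (xi I v2 <= p)%O -> (xi I v4 <= p)%O -> (xi I v3 <= p)%O.
Proof.
rewrite /xi; case: ifP => _; last by case: ifP => /=.
by case: p => i b; rewrite !leEprod /= => /andP[_ ->] /andP[-> _].
Qed.

(** The values of [xi I] include both ends of each row that [I] meets, and convexity of [J] fills in
    these rows. *)
Lemma subset_xi (J : pinterval (ladder n)) :
  reflect (forall a, xi I a \in val J) (val I \subset val J).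
Proof.
apply: (iffP fintype.subsetP) => [IJ a|xJ p pI].
  apply: IJ; rewrite /xi.
  have [mx|nmx] := boolP (meets_x I); have [my|nmy] := boolP (meets_y I) => /=.
  - have [xfI xf] := xfirstP mx; have [xlI xl] := xlastP mx.
    have [yfI yf] := yfirstP my; have [ylI yl] := ylastP my.
    have [c [cx cy]] := crossing mx my.
    (* Only [v3] is not by definition an end of a row; its image lies between the first [x] and the
       [y] of a crossing column. *)
    case: a => //; apply: (interval_convex xfI cy); rewrite leEprod /= ?lexx //=.
    by rewrite leEord xf.
  - by have [xfI _] := xfirstP mx; have [xlI _] := xlastP mx; case: a.
  - by have [yfI _] := yfirstP my; have [ylI _] := ylastP my; case: a.
  - by have := meets_xy I; rewrite (negPf nmx) (negPf nmy).
have row_x i : lx i \in val I -> lx (xfirst I) \in val J -> lx (xlast I) \in val J ->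
    lx i \in val J.
  move=> iI fJ lJ; have mx : meets_x I by apply/existsP; exists i.
  have [_ xf] := xfirstP mx; have [_ xl] := xlastP mx.
  by apply: (interval_convex fJ lJ); rewrite leEprod /= lexx leEord ?xf ?xl.
have row_y i : ly i \in val I -> ly (yfirst I) \in val J -> ly (ylast I) \in val J ->
    ly i \in val J.
  move=> iI fJ lJ; have my : meets_y I by apply/existsP; exists i.
  have [_ yf] := yfirstP my; have [_ yl] := ylastP my.
  by apply: (interval_convex fJ lJ); rewrite leEprod /= lexx leEord ?yf ?yl.
have mx i : lx i \in val I -> meets_x I by move=> iI; apply/existsP; exists i.
have my i : ly i \in val I -> meets_y I by move=> iI; apply/existsP; exists i.
case: p pI => i [] pI.
  have {}my := my _ pI; apply: row_y => //.
    by have /= := xJ v2; rewrite /xi my andbT; case: (meets_x I).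
  by have /= := xJ v1; rewrite /xi my andbT; case: (meets_x I).
have {}mx := mx _ pI; apply: row_x => //.
  by have /= := xJ v4; rewrite /xi mx /=; case: (meets_y I).
by have /= := xJ v5; rewrite /xi mx /=; case: (meets_y I).
Qed.

Definition restrict_rhom X M (f : rhom X M) : rhom (restrict I X) (restrict I M) :=
  @RHom _ _ (restrict I X) (restrict I M) (fun a => f (xi I a))
    (fun a b e => rhom_nat f (xi_le I e)).

Lemma restrict_dsum (T : finType) (E : T -> pmod (ladder n) k) X :
  is_dsum (fun t => E t : rep k _) X -> is_dsum (fun t => restrict I (E t)) (restrict I X).
Proof.
move=> [inj [prj [injK inj0 injS]]].
exists (fun t => restrict_rhom (inj t)), (fun t => restrict_rhom (prj t)).
by split=> [t a|s t a st|a]; [exact: injK | exact: inj0 | exact: injS].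
Qed.

Lemma restrict_int_thin (J : pinterval (ladder n)) :
  val I \subset val J -> iso (restrict I (int_mod k J)) (thin k).
Proof.
move=> /subset_xi xJ; apply: iso_sym.
pose one (a : zvertex) : restrict I (int_mod k J) a := int_one k J (xi I a).
have fP (a b : zvertex) (e : zarrow a b) : (line (one b) \o rep_map (thin k) e)%VF =
    (@rep_map _ _ (restrict I (int_mod k J)) a b e \o line (one a))%VF.
  apply/lfunP => c; rewrite [LHS]comp_lfunE [RHS]comp_lfunE id_lfunE !lineE linearZ /=.
  congr (_ *: _); apply/esym.
  exact: (int_map_one k (xi_le I e : @arrow (poset_quiver _) (xi I a) (xi I b)) (xJ a)).
apply: (rhom_bijective_iso
  (f := @RHom _ _ (thin k) (restrict I (int_mod k J)) (fun a => line (one a)) fP)) => a.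
  move=> c d /=; rewrite !lineE => /eqP; rewrite -subr_eq0 -scalerBl scaler_eq0.
  by rewrite (negPf (int_one_neq0 k (xJ a))) orbF subr_eq0 => /eqP.
move=> v; exists (\sum_i (v : 'rV_(xi I a \in val J)) 0 i).
by rewrite /= lineE -int_oneE.
Qed.

Lemma full_mult_int (J : pinterval (ladder n)) :
  full_mult (restrict I (int_mod k J)) = (val I \subset val J).
Proof.
have [IJ|nxJ] := boolP (val I \subset val J).
  by rewrite (full_mult_iso (restrict_int_thin IJ)) full_mult_thin.
apply/eqP; rewrite -leqn0 leqNgt; apply: contra nxJ => /full_mult_retract[i [p pi]].
apply/subset_xi => a; apply: contraT => aJ.
(* If [J] misses [xi I a], the identity of [thin] at [a] factors through a zero space. *)
have /eqP : (1 : k^o) = 0; last by rewrite oner_eq0.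
rewrite -[LHS](id_lfunE (1 : k^o)) -(pi a) comp_lfunE [i a 1]int_oneE.
by rewrite (int_one0 _ aJ) scaler0 linear0.
Qed.

(** An element of the gluing space is a section on the up-set generated by [xi I v2] and [xi I v4],
    vanishing above the ends selected by [c] and [d]. Such sections lift along approximations. *)
Lemma gluing_lift c d X M (f : rhom X M) : right_approx f ->
  forall w, w \in gluing c d (restrict I M) ->
  exists2 v, v \in gluing c d (restrict I X) & pairs_map (restrict_rhom f) v = w.
Proof.
move=> fA [a b]; rewrite mem_gluing => /and3P[/eqP /= ab c0 d0].
pose U : {set ladder n} := [set p | (xi I v2 <= p)%O || (xi I v4 <= p)%O].
pose W : {set ladder n} := [set p | c && (xi I v1 <= p)%O || d && (xi I v5 <= p)%O].
have upU (p q : ladder n) : (p <= q)%O -> p \in U -> q \in U.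
  by move=> pq; rewrite !inE => /orP[] /le_trans/(_ pq) ->; rewrite ?orbT.
have upW (p q : ladder n) : (p <= q)%O -> p \in W -> q \in W.
  by move=> pq; rewrite !inE => /orP[] /andP[-> /le_trans/(_ pq) ->]; rewrite ?orbT.
(* Transport [a] or [b] to [p]. Above both sources the results agree, since [p] is then above
   [xi I v3], where [a] and [b] are glued; outside [U] the value 0 is arbitrary. *)
have sP (p : ladder n) : exists sp : M p,
    (forall h : (xi I v2 <= p)%O, sp = @rep_map _ (poset_quiver _) M _ _ h a) /\
    (forall h : (xi I v4 <= p)%O, sp = @rep_map _ (poset_quiver _) M _ _ h b).
  have [h2|nh2] := pselect (xi I v2 <= p)%O; have [h4|nh4] := pselect (xi I v4 <= p)%O.
  - exists (@rep_map _ (poset_quiver _) M _ _ h2 a); split=> h.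
      by have -> : h = h2 by exact: bool_irrelevance.
    have h3 := xi_le_v3 h2 h4.
    rewrite -(pmod_comp M (xi_le I alpha2) h3 h2) -(pmod_comp M (xi_le I alpha3) h3 h).
    by rewrite !comp_lfunE ab.
  - by exists (@rep_map _ (poset_quiver _) M _ _ h2 a); split=> h //;
    have -> : h = h2 by exact: bool_irrelevance.
  - by exists (@rep_map _ (poset_quiver _) M _ _ h4 b); split=> h //;
    have -> : h = h4 by exact: bool_irrelevance.
  - by exists 0; split.
pose s p := projT1 (cid (sP p)).
have s2 p (h : (xi I v2 <= p)%O) : s p = @rep_map _ (poset_quiver _) M _ _ h a.
  exact: (proj1 (projT2 (cid (sP p)))).
have s4 p (h : (xi I v4 <= p)%O) : s p = @rep_map _ (poset_quiver _) M _ _ h b.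
  exact: (proj2 (projT2 (cid (sP p)))).
have sV : vanishing_section U W s.
  split=> [p q h|p]; rewrite !inE => /orP[].
  - move=> hp; rewrite (s2 _ hp) (s2 _ (le_trans hp h)) -comp_lfunE.
    by rewrite (pmod_comp M hp h (le_trans hp h)).
  - move=> hp; rewrite (s4 _ hp) (s4 _ (le_trans hp h)) -comp_lfunE.
    by rewrite (pmod_comp M hp h (le_trans hp h)).
  - move=> /andP[cT h]; rewrite (s2 _ (le_trans (xi_le I alpha1) h)).
    rewrite -(pmod_comp M (xi_le I alpha1) h _) comp_lfunE.
    by move/implyP/(_ cT)/eqP: c0 => /= ->; rewrite linear0.
  - move=> /andP[dT h]; rewrite (s4 _ (le_trans (xi_le I alpha4) h)).
    rewrite -(pmod_comp M (xi_le I alpha4) h _) comp_lfunE.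
    by move/implyP/(_ dT)/eqP: d0 => /= ->; rewrite linear0.
have [x [xU xW] fx] := lift_section fA upU upW sV.
have U2 : xi I v2 \in U by rewrite inE lexx.
have U4 : xi I v4 \in U by rewrite inE lexx orbT.
exists ((x (xi I v2), x (xi I v4)) : pairs (restrict I X)).
  rewrite (@mem_gluing _ c d (restrict I X)) /= !xU // eqxx /=.
  by apply/andP; split; apply/implyP => t; apply/eqP/xW; rewrite inE t lexx ?orbT.
rewrite pairs_mapE /= !fx // (s2 _ (lexx _)) (s4 _ (lexx _)) !pmod_id.
by rewrite !id_lfunE.
Qed.

Lemma dim_gluing_approx c d (K X M : pmod (ladder n) k) (i : rhom K X) (f : rhom X M) :
    right_approx f -> (forall p, injective (i p)) -> (forall p, limg (i p) = lker (f p)) ->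
  \dim (gluing c d (restrict I X)) =
    (\dim (gluing c d (restrict I K)) + \dim (gluing c d (restrict I M)))%N.
Proof.
move=> fA i_inj if_exact.
apply: (@dim_gluing_exact _ _ _ _ (restrict_rhom i) (restrict_rhom f)) => [a|a|w].
- exact: i_inj.
- exact: if_exact.
- exact: gluing_lift.
Qed.

Lemma full_mult_approx (K X M : pmod (ladder n) k) (i : rhom K X) (f : rhom X M) :
    right_approx f -> (forall p, injective (i p)) -> (forall p, limg (i p) = lker (f p)) ->
  full_mult (restrict I X) = (full_mult (restrict I K) + full_mult (restrict I M))%N.
Proof.
move=> fA i_inj if_exact; apply/eqP; rewrite -eqz_nat PoszD !full_multE.
by rewrite !(dim_gluing_approx _ _ fA i_inj if_exact); apply/eqP; lia.
Qed.

Lemma ker_incl_inj X M (f : rhom X M) p : injective (ker_incl f p).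
Proof. by move=> u v; rewrite !lfunE /=; exact: val_inj. Qed.

Lemma limg_ker_incl X M (f : rhom X M) p : limg (ker_incl f p) = lker (f p).
Proof.
apply/eqP; rewrite eqEsubv; apply/andP; split; apply/subvP => v.
  by case/memv_imgP=> u _ ->; rewrite lfunE /=; exact: subvsP.
move=> vK; apply/memv_imgP; exists (Subvs vK); first exact: memvf.
by rewrite lfunE.
Qed.

(** The resolution breaks into short exact sequences of kernels, each ending in an approximation, so
    the alternating sum telescopes. *)
Lemma full_mult_resolution M (X : int_resolution M) r :
  has_length X r ->
  (full_mult (restrict I M))%:Z =
    \sum_(0 <= i < r.+1) (-1) ^+ i * (full_mult (restrict I (X i)))%:Z.
Proof.
move=> X_length.
pose kd i := ker_pmod (res_diff X i).
have e0 : full_mult (restrict I (X 0%N)) =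
    (full_mult (restrict I (ker_pmod (res_aug X))) + full_mult (restrict I M))%N.
  apply: (full_mult_approx (i := ker_incl (res_aug X)) (res_aug_approx X)) => p.
    exact: ker_incl_inj.
  exact: limg_ker_incl.
have kerE (Y Z N : pmod (ladder n) k) (g : rhom Y Z) (f : rhom Z N) :
    induces_ker_approx g f -> full_mult (restrict I Y) =
      (full_mult (restrict I (ker_pmod g)) + full_mult (restrict I (ker_pmod f)))%N.
  move=> [g' [gE g'A]]; apply: (full_mult_approx (i := ker_incl g) g'A) => p.
    exact: ker_incl_inj.
  (* Exactness for [g']: it has the same kernel as [g], because the inclusion of [ker f] is
     injective. *)
  rewrite limg_ker_incl; apply/vspaceP => v; rewrite !memv_ker gE comp_lfunE.
  apply/eqP/eqP => [e|->]; last exact: linear0.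
  by apply: (@ker_incl_inj _ _ f p); rewrite e linear0.
(* Syzygies, shifted by one: [K 0] is the kernel of the augmentation, and [K i] sits inside the term
   [X i]. *)
pose K i := if i is j.+1 then ker_pmod (res_diff X j) else ker_pmod (res_aug X).
have eS i : full_mult (restrict I (X i.+1)) =
    (full_mult (restrict I (K i.+1)) + full_mult (restrict I (K i)))%N.
  by case: i => [|i]; apply: kerE; [exact: res_diff0_approx | exact: res_diff_approx].
have partial m : \sum_(0 <= i < m.+1) (-1) ^+ i * (full_mult (restrict I (X i)))%:Z =
    (full_mult (restrict I M))%:Z + (-1) ^+ m * (full_mult (restrict I (K m)))%:Z.
  elim: m => [|m IH]; first by rewrite big_nat1 e0 !expr0 !mul1r PoszD addrC.
  by rewrite big_nat_recr //= IH eS PoszD exprS; ring.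
(* The remainder after [r] vanishes: [eS r] bounds it by the value on the zero term [X r.+1], of
   which [thin] cannot be a retract. *)
have K0 : full_mult (restrict I (K r)) = 0%N.
  apply/eqP; rewrite -leqn0; have := eS r.
  suff -> : full_mult (restrict I (X r.+1)) = 0%N by lia.
  apply/eqP; rewrite -leqn0 leqNgt; apply/negP => /full_mult_retract[i [p pi]].
  have /eqP : (1 : k^o) = 0; last by rewrite oner_eq0.
  rewrite -[LHS](id_lfunE (1 : k^o)) -(pi v1) comp_lfunE.
  by rewrite [X in p v1 X](is_zeroP (X_length r.+1 (leqnn _))) linear0.
by rewrite partial K0 mulr0 addr0.
Qed.

Lemma full_mult_int_sum (d : pinterval (ladder n) -> nat) X : is_int_sum d X ->
  full_mult (restrict I X) = (\sum_(J : pinterval (ladder n) | val I \subset val J) d J)%N.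
Proof.
move=> dX; rewrite (full_mult_dsum (restrict_dsum dX)).
transitivity (\sum_(J : pinterval (ladder n)) \sum_(j < d J) (val I \subset val J))%N.
  rewrite sig_big_dep; apply: eq_bigr => t _; exact: full_mult_int.
rewrite [RHS]big_mkcond /=; apply: eq_bigr => J _.
by rewrite sum_nat_const card_ord; case: ifP => _; rewrite ?muln1 ?muln0.
Qed.

End LadderMultiplicity.

Theorem theorem5p5 (k : fieldType) (n : nat) (n_gt0 : (1 <= n)%N)
    (r : nat) (r_gldim : is_int_res_gldim (ladder n) k r)
    (M : pmod (ladder n) k) (X : int_resolution M) (X_length : has_length X r)
    (d : nat -> pinterval (ladder n) -> nat)
    (X_terms : forall i : nat, (i <= r)%N -> is_int_sum (d i) (X i))
    (I : pinterval (ladder n)) :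
  (compressed_multiplicity M I)%:Z =
    \sum_(J : pinterval (ladder n) | val I \subset val J)
      \sum_(0 <= i < r.+1) (-1) ^+ i * (d i J)%:Z.
Proof.
(* The compression of [V_I] itself is thin, since [I] contains [I]. *)
rewrite /compressed_multiplicity multiplicity_thin; last exact/restrict_int_thin.
rewrite (full_mult_resolution I X_length) exchange_big /=; apply: eq_big_nat => i /andP[_ ir].
by rewrite (full_mult_int_sum _ (X_terms i ir)) (big_morph Posz PoszD (erefl _)) mulr_sumr.
Qed.
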